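(* Let $\mathcal{S}_C$ be the basis of the space of $L\times L$ Hermitian circulant matrices (over $\mathbb{R}$) given, for $L$ odd, by $$\mathcal{S}_C=\{I_L\}\cup\{C_1,\ldots,C_{\frac{L-1}{2}}\}\cup\{\tilde C_1,\ldots,\tilde C_{\frac{L-1}{2}}\}$$ and, for $L$ even, by $$\mathcal{S}_C=\{I_L\}\cup\{C_1,\ldots,C_{\frac{L}{2}-1}\}\cup\{\tilde C_1,\ldots,\tilde C_{\frac{L}{2}-1}\}\cup\{T_{\frac{L}{2}}\}.$$ Then a set $\mathcal{K}\subset\{0,\ldots,L-1\}$ defines an $\mathcal{S}_C$-covariance sampler if and only if $\Delta_L(\mathcal{K})=\{0,\ldots,L-1\}$.
   Context: Let $J_L$ be the $L\times L$ matrix whose $(m,n)$ entry is $1$ if $n-m=1$ and $0$ otherwise (indices start at $0$). For $l\ge 1$, $T_l=J_L^l+(J_L^l)^T$ and $\tilde T_l=\jmath J_L^l-\jmath(J_L^l)^T$, with $\jmath$ the imaginary unit. For $l=1,\ldots,\lfloor (L-1)/2\rfloor$, $C_l=T_l+T_{L-l}$ and $\tilde C_l=\tilde T_l-\tilde T_{L-l}$. For integers $x$ and $A\ge1$, $(x)_A$ denotes the remainder in $\{0,\ldots,A-1\}$ of $x$ modulo $A$. The $A$-modular difference set of a set $\mathcal{A}$ of integers is $\Delta_A(\mathcal{A})=\{\delta\ge 0:\ \exists a_1,a_2\in\mathcal{A}\text{ such that }\delta=(a_2-a_1)_A\}$. Covariance samplers: given a linearly independent set (over $\mathbb{R}$)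 $\mathcal{S}$ of $L\times L$ Hermitian Toeplitz matrices, a matrix $\bar\Phi\in\mathbb{C}^{K\times L}$ defines an $\mathcal{S}$-covariance sampler if the map $\phi:\mathrm{span}_{\mathbb{R}}\,\mathcal{S}\to\mathrm{span}_{\mathbb{R}}\{\bar\Phi\Sigma_s\bar\Phi^H:\Sigma_s\in\mathcal{S}\}$, $\phi(\Sigma)=\bar\Phi\Sigma\bar\Phi^H$, is invertible. A set $\mathcal{K}\subset\{0,\ldots,L-1\}$ is said to define an $\mathcal{S}$-covariance sampler if the (sparse) matrix $\bar\Phi\in\mathbb{C}^{|\mathcal{K}|\times L}$ formed by the rows of $I_L$ with indices in $\mathcal{K}$ (in increasing order) does. *)

(* Defs.v *)
From mathcomp Require Export all_boot all_order all_algebra.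
From mathcomp Require Export classical_sets functions reals complex.
From mathcomp Require Import zify ring lra.

Set Implicit Arguments.
Unset Strict Implicit.
Unset Printing Implicit Defensive.

Import Order.TTheory GRing.Theory Num.Theory.

Local Open Scope sesquilinear_scope.
Local Open Scope classical_set_scope.
Local Open Scope complex_scope.
Local Open Scope ring_scope.

(* 'M[R[i]]_(m, n) is a module over R[i] only; real scalars act through the
   embedding c |-> c%:C. *)
Definition real_span (R : realType) m n (S : set 'M[R[i]]_(m, n)) :
    set 'M[R[i]]_(m, n) :=
  [set A | exists k (c : 'I_k -> R) (v : 'I_k -> 'M[R[i]]_(m, n)),
     (forall i, S (v i)) /\ A = \sum_i (c i)%:C *: v i].

Definition real_lin_indep (R : realType) m n (S : set 'M[R[i]]_(m, n)) : Prop :=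
  forall k (c : 'I_k -> R) (v : 'I_k -> 'M[R[i]]_(m, n)),
    (forall i, S (v i)) -> injective v -> \sum_i (c i)%:C *: v i = 0 ->
    forall i, c i = 0.

Definition hermitian (R : realType) L (A : 'M[R[i]]_L) : Prop := A ^t* = A.

Definition toeplitz (T : Type) L (A : 'M[T]_L) : Prop :=
  forall m n m' n' : 'I_L, (n + m' = n' + m)%N -> A m n = A m' n'.

Definition circulant (T : Type) L (A : 'M[T]_L) : Prop :=
  forall m n m' n' : 'I_L, (n + m' = n' + m %[mod L])%N -> A m n = A m' n'.

Definition compress (R : realType) k L (Phi : 'M[R[i]]_(k, L)) (A : 'M[R[i]]_L) :
    'M[R[i]]_k :=
  Phi *m A *m Phi ^t*.

(* Invertibility of the map is bijectivity between the two real spans. The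
   notion is meant for S a real-linearly independent set of Hermitian Toeplitz
   matrices; see hermitian_circulant_basisP for the set used here. *)
Definition covariance_sampler (R : realType) k L
    (S : set 'M[R[i]]_L) (Phi : 'M[R[i]]_(k, L)) : Prop :=
  set_bij (real_span S) (real_span (compress Phi @` S)) (compress Phi).

(* enum_val lists the elements of K in increasing order. *)
Definition row_selection (R : realType) L (K : {set 'I_L}) : 'M[R[i]]_(#|K|, L) :=
  rowsub (fun j : 'I_#|K| => enum_val j) 1%:M.

Definition set_covariance_sampler (R : realType) L
    (S : set 'M[R[i]]_L) (K : {set 'I_L}) : Prop :=
  covariance_sampler S (row_selection R K).

Definition modular_difference_set (A : nat) (X : set int) : set int :=
  [set d | 0 <= d /\ exists a1 a2, [/\ X a1, X a2 & d = ((a2 - a1) %% A)%Z]].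

Section Basis.
Variables (R : realType) (L : nat).

Definition shiftJ : 'M[R[i]]_L := \matrix_(m, n) (n == m.+1 :> nat)%:R.
Definition toepT (l : nat) : 'M[R[i]]_L := shiftJ ^+ l + (shiftJ ^+ l)^T.
Definition toepTt (l : nat) : 'M[R[i]]_L :=
  'i%C *: shiftJ ^+ l - 'i%C *: (shiftJ ^+ l)^T.
Definition circC (l : nat) : 'M[R[i]]_L := toepT l + toepT (L - l).
Definition circCt (l : nat) : 'M[R[i]]_L := toepTt l - toepTt (L - l).

Definition hermitian_circulant_basis : set 'M[R[i]]_L :=
  if odd L then
    [set 1%:M]
    `|` circC @` [set l | (1 <= l <= (L - 1) %/ 2)%N]
    `|` circCt @` [set l | (1 <= l <= (L - 1) %/ 2)%N]
  else
    [set 1%:M]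
    `|` circC @` [set l | (1 <= l <= L %/ 2 - 1)%N]
    `|` circCt @` [set l | (1 <= l <= L %/ 2 - 1)%N]
    `|` [set toepT (L %/ 2)].

End Basis.
Arguments hermitian_circulant_basis : clear implicits.

Section BasisProof.
Variables (R : realType) (L : nat).
Hypothesis L_gt0 : (0 < L)%N.
Local Notation M := 'M[R[i]]_L.

Lemma shiftJXE l (m n : 'I_L) :
  (shiftJ R L ^+ l) m n = (n == m + l :> nat)%N%:R.
Proof.
elim: l m n => [|l IH] m n.
  by rewrite expr0 addn0 !mxE eq_sym.
rewrite exprS mxE; have [lt|ge] := ltnP m.+1 L.
  rewrite (bigD1 (Ordinal lt)) //= big1 ?addr0; last first.
    move=> k nk; rewrite mxE (_ : (k == m.+1 :> nat) = false) ?mul0r //.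
    by apply: contraNF nk => /eqP e; apply/eqP/val_inj.
  by rewrite mxE eqxx mul1r IH /= addSnnS.
rewrite big1 => [|k _].
  by rewrite ltn_eqF //; apply: leq_trans (ltn_ord n) _; lia.
by rewrite mxE ltn_eqF ?mul0r // (leq_trans (ltn_ord k)).
Qed.

Let d0 : 'I_L := Ordinal L_gt0.

(* (n - m) mod L, in nat arithmetic *)
Definition cdist (m n : 'I_L) : 'I_L := Ordinal (ltn_pmod (n + (L - m)) L_gt0).

Lemma cdistE m n : cdist m n = (if m <= n then n - m else n + L - m)%N :> nat.
Proof.
rewrite /=; have := ltn_ord m; have := ltn_ord n; case: ifP => h hn hm.
  have -> : (n + (L - m) = (n - m) + L)%N by lia.
  by rewrite modnDr modn_small //; lia.
by rewrite modn_small; lia.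
Qed.

Lemma circCE l m n : (0 < l < L)%N -> circC R L l m n =
  (cdist m n == l :> nat)%:R + (cdist m n == L - l :> nat)%N%:R.
Proof.
move=> hl; rewrite cdistE !mxE !shiftJXE; have := ltn_ord m; have := ltn_ord n.
move=> hn hm.
have -> : ((if (m <= n)%N then (n - m)%N else (n + L - m)%N) == l)%:R =
   (n == m + l :> nat)%N%:R + (m == n + (L - l) :> nat)%N%:R :> R[i].
  rewrite -natrD; congr (_ %:R); case: ifP => h; lia.
have -> : ((if (m <= n)%N then (n - m)%N else (n + L - m)%N) == (L - l)%N)%:R =
   (n == m + (L - l) :> nat)%N%:R + (m == n + l :> nat)%N%:R :> R[i].
  rewrite -natrD; congr (_ %:R); case: ifP => h; lia.
ring.
Qed.

Lemma circCtE l m n : (0 < l < L)%N -> circCt R L l m n =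
  'i%C * ((cdist m n == l :> nat)%:R - (cdist m n == L - l :> nat)%N%:R).
Proof.
move=> hl; rewrite cdistE !mxE !shiftJXE; have := ltn_ord m; have := ltn_ord n.
move=> hn hm.
have -> : ((if (m <= n)%N then (n - m)%N else (n + L - m)%N) == l)%:R =
   (n == m + l :> nat)%N%:R + (m == n + (L - l) :> nat)%N%:R :> R[i].
  rewrite -natrD; congr (_ %:R); case: ifP => h; lia.
have -> : ((if (m <= n)%N then (n - m)%N else (n + L - m)%N) == (L - l)%N)%:R =
   (n == m + (L - l) :> nat)%N%:R + (m == n + l :> nat)%N%:R :> R[i].
  rewrite -natrD; congr (_ %:R); case: ifP => h; lia.
ring.
Qed.

Lemma toepTE m n : ~~ odd L ->
  toepT R L (L %/ 2) m n = (cdist m n == L %/ 2 :> nat)%N%:R.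
Proof.
move=> oL; rewrite cdistE !mxE !shiftJXE; have := ltn_ord m; have := ltn_ord n.
move=> hn hm; have := odd_double_half L; rewrite (negbTE oL) -divn2 => hL.
rewrite -natrD; congr (_ %:R); case: ifP => h; lia.
Qed.

Lemma idE m n : (1%:M : M) m n = (cdist m n == 0 :> nat)%:R.
Proof.
rewrite cdistE !mxE; have := ltn_ord m; have := ltn_ord n => hn hm.
by congr (_ %:R); rewrite -val_eqE /=; case: ifP => h; lia.
Qed.

Lemma real_span_gen (S : set M) (A : M) : S A -> real_span S A.
Proof.
move=> SA; exists 1%N, (fun=> 1), (fun=> A); split=> //.
by rewrite big_ord1 scale1r.
Qed.

Lemma real_span0 (S : set M) : real_span S 0.
Proof. by exists 0%N, (fun=> 0), (fun=> 0); split; [case|rewrite big_ord0]. Qed.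

Lemma real_spanD (S : set M) (A B : M) :
  real_span S A -> real_span S B -> real_span S (A + B).
Proof.
move=> [k [c [v [Sv ->]]]] [k' [c' [v' [Sv' ->]]]].
exists (k + k')%N, (fun i => match fintype.split i with inl j => c j | inr j => c' j end),
  (fun i => match fintype.split i with inl j => v j | inr j => v' j end); split.
  by move=> i; case: (fintype.split i).
rewrite big_split_ord /=; congr (_ + _); apply: eq_bigr => i _.
  by rewrite (unsplitK (inl i)).
by rewrite (unsplitK (inr i)).
Qed.

Lemma real_spanZ (S : set M) (a : R) (A : M) : real_span S A -> real_span S (a%:C *: A).
Proof.
move=> [k [c [v [Sv ->]]]]; exists k, (fun i => a * c i), v; split=> //.
by rewrite scaler_sumr; apply: eq_bigr => i _; rewrite scalerA -rmorphM.
Qed.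

Local Notation SC := (hermitian_circulant_basis R L).

Lemma hermitian_circulant_basisE A : SC A <->
  [\/ A = 1%:M, exists2 l, (1 <= l <= (L - 1) %/ 2)%N & A = circC R L l,
      exists2 l, (1 <= l <= (L - 1) %/ 2)%N & A = circCt R L l
    | ~~ odd L /\ A = toepT R L (L %/ 2)].
Proof.
rewrite /hermitian_circulant_basis; case: ifPn => oL.
  split=> [[[->|[l hl <-]]|[l hl <-]]|[->|[l hl ->]|[l hl ->]|[]//]].
  - by constructor 1.
  - by constructor 2; exists l.
  - by constructor 3; exists l.
  - by left; left.
  - by left; right; exists l.
  - by right; exists l.
have -> : (L %/ 2 - 1 = (L - 1) %/ 2)%N.
  by have := odd_double_half L; rewrite (negbTE oL) -divn2; lia.
split=> [[[[->|[l hl <-]]|[l hl <-]]|->]|[->|[l hl ->]|[l hl ->]|[_ ->]]].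
- by constructor 1.
- by constructor 2; exists l.
- by constructor 3; exists l.
- by constructor 4.
- by left; left; left.
- by left; left; right; exists l.
- by left; right; exists l.
- by right.
Qed.

Lemma cdist_sym (m n : 'I_L) : cdist n m = ((L - cdist m n) %% L)%N :> nat.
Proof.
rewrite !cdistE; have := ltn_ord m; have := ltn_ord n => hn hm.
case: ltngtP => h; [|by rewrite modn_small; lia|].
  by rewrite modn_small; lia.
by rewrite (_ : (L - (n - m) = L)%N) ?modnn; lia.
Qed.

Lemma circulantP (A : M) :
  circulant A <-> forall m n, A m n = A d0 (cdist m n).
Proof.
split=> [cA m n|cA m n m' n' e].
  apply: cA; rewrite cdistE /=; have := ltn_ord m; case: ifP => h hm.
    by congr (_ %% _)%N; lia.
  by rewrite (_ : (n + L - m + m = n + L)%N) ?modnDr ?addn0 //; lia.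
rewrite cA [RHS]cA; congr (A _ _); apply: val_inj => /=.
have := ltn_ord m; have := ltn_ord m' => hm' hm.
apply/eqP; rewrite -(eqn_modDr (m + m')%N); apply/eqP.
rewrite (_ : (n + (L - m) + (m + m') = n + m' + L)%N); last by lia.
rewrite (_ : (n' + (L - m') + (m + m') = n' + m + L)%N); last by lia.
by rewrite !modnDr.
Qed.

Lemma cdist0 d : cdist d0 d = d.
Proof. by apply: val_inj; rewrite /= subn0 modnDr modn_small. Qed.

Lemma hermitianP (A : M) : hermitian A <-> forall m n, A m n = (A n m)^*%C.
Proof.
split=> [hA m n|hA]; first by rewrite -{1}hA !mxE.
by apply/matrixP => m n; rewrite !mxE [RHS]hA.
Qed.

Lemma hermitian_circulant_basis_sub A : SC A -> hermitian A /\ circulant A.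
Proof.
have cdl m n := ltn_ord (cdist m n).
have symE m n l : (0 < l < L)%N -> (cdist n m == l :> nat) = (cdist m n == L - l :> nat)%N.
  move=> hl; rewrite cdist_sym; have := cdl m n.
  case: (posnP (cdist m n)) => [->|h] hc; first by rewrite subn0 modnn; lia.
  by rewrite modn_small; lia.
have sym0 m n : (cdist n m == 0 :> nat)%N = (cdist m n == 0 :> nat)%N.
  rewrite cdist_sym; have := cdl m n.
  case: (posnP (cdist m n)) => [->|h] hc; first by rewrite subn0 modnn; lia.
  by rewrite modn_small; lia.
have conj_nat (b : nat) : ((b%:R : R[i])^*)%C = b%:R by rewrite rmorph_nat.
move=> /hermitian_circulant_basisE [->|[l hl ->]|[l hl ->]|[oL ->]].
- split; first by apply/hermitianP => m n; rewrite !idE conj_nat sym0.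
  by apply/circulantP => m n; rewrite !idE cdist0.
- have hl1 : (0 < l < L)%N by lia.
  have hl2 : (0 < L - l < L)%N by lia.
  split; last by apply/circulantP => m n; rewrite !circCE // cdist0.
  apply/hermitianP => m n; rewrite !circCE // rmorphD /= !conj_nat.
  by rewrite (symE m n l) // (symE m n (L - l)%N) // subKn 1?addrC //; lia.
- have hl1 : (0 < l < L)%N by lia.
  have hl2 : (0 < L - l < L)%N by lia.
  split; last by apply/circulantP => m n; rewrite !circCtE // cdist0.
  have conjE (b b' : bool) :
      conjc ('i%C * (b%:R - b'%:R)) = 'i%C * (b'%:R - b%:R) :> R[i].
    by apply/eqP; case: b; case: b'; rewrite eq_complex /= !(mulr0, mul0r, mulr1, mul1r); apply/andP; split; apply/eqP; ring.
  apply/hermitianP => m n; rewrite !circCtE // conjE.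
  by rewrite (symE m n l) // (symE m n (L - l)%N) // subKn //; lia.
- split; last by apply/circulantP => m n; rewrite !toepTE // cdist0.
  have := odd_double_half L; rewrite (negbTE oL) -divn2 => hL.
  apply/hermitianP => m n; rewrite !toepTE // conj_nat symE; last by lia.
  by congr ((_ == _)%N%:R); lia.
Qed.

Lemma hermitian_circulant_basis_span :
  real_span SC = [set A | hermitian A /\ circulant A].
Proof.
apply/seteqP; split=> A /=.
  move=> [k [c [v [Sv ->]]]].
  split.
    apply/hermitianP => m n; rewrite !summxE rmorph_sum /=; apply: eq_bigr => i _.
    have [/hermitianP h _] := hermitian_circulant_basis_sub (Sv i).
    by rewrite !mxE rmorphM /= -h /= oppr0.
  apply/circulantP => m n; rewrite !summxE; apply: eq_bigr => i _.
  have [_ /circulantP h] := hermitian_circulant_basis_sub (Sv i).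
  by rewrite !mxE h.
move=> [/hermitianP hA /circulantP cA].
pose a (d : nat) : R[i] := A d0 (insubd d0 d).
have aE d : A d0 d = a (d : 'I_L) by rewrite /a valKd.
have asym d : (d < L)%N -> a ((L - d) %% L)%N = (a d)^*%C.
  move=> dL; pose e := Ordinal dL.
  rewrite /a -[insubd d0 d]/(insubd d0 (e : nat)) valKd -hA [RHS]cA; congr (A _ _).
  by apply: ord_inj; rewrite cdist_sym cdist0 val_insubd ltn_mod L_gt0.
have a0 : a 0%N = (complex.Re (a 0%N))%:C.
  have := asym 0%N L_gt0; rewrite subn0 modnn; case: (a 0%N) => x y /eqP.
  rewrite eq_complex /= => /andP[_ /eqP h]; apply/eqP; rewrite eq_complex /= eqxx /=.
  by apply/eqP; lra.
pose T := if odd L then 0 else (complex.Re (a (L %/ 2)%N))%:C *: toepT R L (L %/ 2).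
have -> : A = (complex.Re (a 0%N))%:C *: 1%:M
   + \sum_(1 <= l < ((L - 1) %/ 2).+1)
       ((complex.Re (a l))%:C *: circC R L l + (complex.Im (a l))%:C *: circCt R L l)
   + T.
  apply/matrixP => m n; rewrite cA aE mxE [in RHS]mxE mxE idE summxE.
  set d : nat := cdist m n.
  have dL : (d < L)%N := ltn_ord _.
  have TE : T m n = (~~ odd L && (d == L %/ 2)%N)%:R * (complex.Re (a (L %/ 2)%N))%:C.
    rewrite /T; case: ifPn => oL; first by rewrite mxE mul0r.
    by rewrite mxE toepTE // mulrC.
  rewrite TE.
  have -> : \sum_(1 <= l < ((L - 1) %/ 2).+1)
      ((complex.Re (a l))%:C *: circC R L l + (complex.Im (a l))%:C *: circCt R L l) m n =
     \sum_(1 <= l < ((L - 1) %/ 2).+1)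
      ((d == l)%N%:R * a l + (d == L - l)%N%:R * (a l)^*%C).
    apply: eq_big_nat => l hl; rewrite mxE [X in X + _ = _]mxE [X in _ + X = _]mxE circCE ?circCtE //; try lia.
    rewrite -/d; case: (a l) => x y /=.
    have -> : (x +i* y) = x%:C + 'i%C * y%:C.
      by apply/eqP; rewrite eq_complex /= !mul0r !mul1r; apply/andP; split; apply/eqP; ring.
    have -> : (x -i* y) = x%:C - 'i%C * y%:C.
      by apply/eqP; rewrite eq_complex /= !mul0r !mul1r; apply/andP; split; apply/eqP; ring.
    by ring.
  have oddL := odd_double_half L; rewrite -divn2 in oddL.
  clearbody d; clear TE T; case: (posnP d) => [d_0|d_gt0].
    rewrite d_0 mulr1 big_nat big1 ?addr0 -?a0; last first.
      move=> l hl; have e1 : (0 == l)%N = false by clear - hl; lia.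
      have e2 : (0 == L - l)%N = false by clear - hl L_gt0; lia.
      rewrite e1 e2.
      by rewrite !mul0r addr0.
    rewrite (_ : _ && _ = false) ?mul0r ?addr0 //.
    by case: (odd L) oddL => //=; lia.
  rewrite mulr0 add0r.
  have [dh|dh] := leqP d ((L - 1) %/ 2).
    rewrite (_ : _ && _ = false) ?mul0r ?addr0; last first.
      by case: (odd L) oddL => //=; lia.
    rewrite (bigD1_seq d) ?iota_uniq ?mem_index_iota //=; last by lia.
    rewrite eqxx (_ : (d == L - d)%N = false) ?mul0r ?mul1r ?addr0; last by lia.
    rewrite big_seq_cond big1 ?addr0 // => l; rewrite mem_index_iota => hl.
    have e1 : (d == l)%N = false by clear - hl dh d_gt0 dL; lia.
    have e2 : (d == L - l)%N = false by clear - hl dh d_gt0 dL; lia.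
    by rewrite e1 e2 !mul0r addr0.
  have [dl|dl] := boolP (~~ odd L && (d == L %/ 2)%N).
    rewrite big_nat big1 ?add0r ?mul1r; last first.
      case: (odd L) dl oddL => //= => /eqP -> oddL l hl.
      have e1 : (L %/ 2 == l)%N = false by clear - hl oddL L_gt0; lia.
      have e2 : (L %/ 2 == L - l)%N = false by clear - hl oddL L_gt0; lia.
      by rewrite e1 e2 !mul0r addr0.
    case: (odd L) dl oddL => //= => /eqP -> oddL.
    have hL : (L %/ 2 < L)%N by lia.
    have := asym _ hL; rewrite modn_small; last by lia.
    rewrite (_ : (L - L %/ 2 = L %/ 2)%N); last by lia.
    case: (a _) => x y /eqP; rewrite eq_complex /= => /andP[_ /eqP h].
    by apply/eqP; rewrite eq_complex /= eqxx /=; apply/eqP; lra.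
  rewrite mul0r addr0.
  rewrite (bigD1_seq (L - d)%N) ?iota_uniq ?mem_index_iota //=; last first.
    by case: (odd L) dl oddL => //=; lia.
  have e : (L - (L - d) = d)%N by lia.
  rewrite e eqxx (_ : (d == L - d)%N = false) ?mul0r ?mul1r ?add0r; last first.
    by case: (odd L) dl oddL => //=; lia.
  rewrite big_seq_cond big1 ?addr0.
    by rewrite -asym ?e ?modn_small //; lia.
  move=> l; rewrite mem_index_iota => hl.
  have e1 : (d == l)%N = false by clear - hl dh d_gt0 dL; lia.
  have e2 : (d == L - l)%N = false by clear - hl dh d_gt0 dL; lia.
  by rewrite e1 e2 !mul0r addr0.
apply: real_spanD; first apply: real_spanD.
- apply/real_spanZ/real_span_gen/hermitian_circulant_basisE; by constructor 1.
- rewrite big_nat; apply: big_ind => [|B B'|l hl]; [exact: real_span0|exact: real_spanD|].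
  apply: real_spanD; apply/real_spanZ/real_span_gen/hermitian_circulant_basisE.
    by constructor 2; exists l => //; lia.
  by constructor 3; exists l => //; lia.
- rewrite /T; case: ifPn => oL; first exact: real_span0.
  by apply/real_spanZ/real_span_gen/hermitian_circulant_basisE; constructor 4.
Qed.

Lemma hermitian_circulant_basis_lin_indep : real_lin_indep SC.
Proof.
have oddL := odd_double_half L; rewrite -divn2 in oddL.
have bL l : (1 <= l <= (L - 1) %/ 2)%N -> (l < L)%N by lia.
have bh l : (1 <= l <= (L - 1) %/ 2)%N -> (l <= L %/ 2)%N by lia.
have b0 l : (1 <= l <= (L - 1) %/ 2)%N -> (0 == l)%N = false by lia.
have b1 l : (1 <= l <= (L - 1) %/ 2)%N -> (l == 0)%N = false by lia.
have e0 : ~~ odd L -> (0 == L %/ 2)%N = false.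
  by case: (odd L) oddL => //=; lia.
have e1 l : ~~ odd L -> (1 <= l <= (L - 1) %/ 2)%N -> (l == L %/ 2)%N = false.
  by case: (odd L) oddL => //=; lia.
have hLL : (L %/ 2 < L)%N by lia.
pose f (b : bool) (d : 'I_L) (A : M) :=
  if b then complex.Im (A d0 d) else complex.Re (A d0 d).
have fD b d A B : f b d (A + B) = f b d A + f b d B.
  by rewrite /f mxE; case: b; case: (A d0 d) => ? ?; case: (B d0 d).
have f0 b d : f b d 0 = 0 by rewrite /f mxE; case: b.
have fZ b d c A : f b d (c%:C *: A) = c * f b d A.
  by rewrite /f mxE; case: b; case: (A d0 d) => x y /=; ring.
have fsum b d k (v : 'I_k -> M) : f b d (\sum_i v i) = \sum_i f b d (v i).
  by apply: (big_morph (f b d)).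
have C1 l (d : 'I_L) : (1 <= l <= (L - 1) %/ 2)%N -> (d <= L %/ 2)%N ->
    circC R L l d0 d = (d == l :> nat)%N%:R.
  move=> hl hd; rewrite circCE ?cdist0; last by lia.
  by rewrite (_ : (d == L - l :> nat)%N = false) ?addr0 //; lia.
have C2 l (d : 'I_L) : (1 <= l <= (L - 1) %/ 2)%N -> (d <= L %/ 2)%N ->
    circCt R L l d0 d = 'i%C * (d == l :> nat)%N%:R.
  move=> hl hd; rewrite circCtE ?cdist0; last by lia.
  by rewrite (_ : (d == L - l :> nat)%N = false) ?subr0 //; lia.
have C0 (d : 'I_L) : (1%:M : M) d0 d = (d == 0 :> nat)%N%:R by rewrite idE cdist0.
have C3 (d : 'I_L) : ~~ odd L -> toepT R L (L %/ 2) d0 d = (d == L %/ 2 :> nat)%N%:R.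
  by move=> oL; rewrite toepTE // cdist0.
have ReN (b : bool) : complex.Re (b%:R : R[i]) = b%:R by case: b.
have ImN (b : bool) : complex.Im (b%:R : R[i]) = 0 by case: b.
have RiN (b : bool) : complex.Re ('i%C * (b%:R : R[i])) = 0 by case: b => /=; ring.
have IiN (b : bool) : complex.Im ('i%C * (b%:R : R[i])) = b%:R by case: b => /=; ring.
have key X : SC X -> exists b d,
    f b d X = 1 /\ forall Y, SC Y -> Y <> X -> f b d Y = 0.
  move=> /hermitian_circulant_basisE [->|[l hl ->]|[l hl ->]|[oL ->]].
  - exists false, d0; split; first by rewrite /f C0 ReN.
    move=> Y /hermitian_circulant_basisE [//|[l hl ->] _|[l hl ->] _|[oL ->] _].
    + by rewrite /f C1 // ReN /= b0.
    + by rewrite /f C2 // RiN.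
    + by rewrite /f C3 // ReN /= e0.
  - exists false, (Ordinal (bL l hl)); split.
      by rewrite /f (C1 l (Ordinal (bL l hl)) hl (bh l hl)) ReN eqxx.
    move=> Y /hermitian_circulant_basisE [-> _|[l' hl' ->]|[l' hl' ->] _|[oL ->] _].
    + by rewrite /f C0 // ReN /= b1.
    + move=> ne; rewrite /f (C1 l' (Ordinal (bL l hl)) hl' (bh l hl)) ReN /=.
      suff /negbTE -> : l != l' by [].
      by apply/negP => /eqP e; apply: ne; rewrite e.
    + by rewrite /f (C2 l' (Ordinal (bL l hl)) hl' (bh l hl)) RiN.
    + by rewrite /f C3 // ReN /= e1.
  - exists true, (Ordinal (bL l hl)); split.
      by rewrite /f (C2 l (Ordinal (bL l hl)) hl (bh l hl)) IiN eqxx.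
    move=> Y /hermitian_circulant_basisE [-> _|[l' hl' ->] _|[l' hl' ->]|[oL ->] _].
    + by rewrite /f C0 // ImN.
    + by rewrite /f (C1 l' (Ordinal (bL l hl)) hl' (bh l hl)) ImN.
    + move=> ne; rewrite /f (C2 l' (Ordinal (bL l hl)) hl' (bh l hl)) IiN /=.
      suff /negbTE -> : l != l' by [].
      by apply/negP => /eqP e; apply: ne; rewrite e.
    + by rewrite /f C3 // ImN.
  - exists false, (Ordinal hLL); split; first by rewrite /f C3 ?ReN ?eqxx.
    move=> Y /hermitian_circulant_basisE [-> _|[l' hl' ->] _|[l' hl' ->] _|[_ ->] //].
    + by rewrite /f C0 // ReN /= eq_sym e0.
    + by rewrite /f C1 ?ReN //= eq_sym e1.
    + by rewrite /f C2 ?RiN.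
move=> k c v Sv vinj vsum i.
have [b [d [fi fj]]] := key _ (Sv i).
have : f b d (\sum_i (c i)%:C *: v i) = 0 by rewrite vsum f0.
rewrite fsum (bigD1 i) //= fZ fi mulr1 big1 ?addr0 // => j ji.
rewrite fZ fj ?mulr0 // => /vinj e; by rewrite e eqxx in ji.
Qed.

Lemma circulant_toeplitz (T : Type) (A : 'M[T]_L) : circulant A -> toeplitz A.
Proof. by move=> cA m n m' n' e; apply: cA; rewrite e. Qed.

Theorem hermitian_circulant_basisP :
  [/\ real_lin_indep SC,
      real_span SC = [set A | hermitian A /\ circulant A] &
      forall A, SC A -> hermitian A /\ toeplitz A].
Proof.
split; [exact: hermitian_circulant_basis_lin_indep
       |exact: hermitian_circulant_basis_span|].
move=> A /hermitian_circulant_basis_sub [hA cA].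
by split=> //; apply: circulant_toeplitz.
Qed.

End BasisProof.

(* Main.v *)
Require Import Defs.
From mathcomp Require Import zify.
Set Implicit Arguments.
Unset Strict Implicit.
Unset Printing Implicit Defensive.

Import Order.TTheory GRing.Theory Num.Theory.
Local Open Scope classical_set_scope.
Local Open Scope ring_scope.

(** The span of the basis is the space of Hermitian circulant matrices, and
    compressing by a row selection restricts a matrix to the indices in [K].
    The entry of a circulant matrix at [(m, n)] depends only on [n - m] mod [L],
    so the compression determines the matrix as soon as every residue is a
    difference of elements of [K]. Conversely, if the residue [d] is not a
    difference, then the nonzero symmetric circulant matrix supported on the
    residues [d] and [- d] has zero compression. *)

Section Compression.
Variables (R : realType) (k L : nat) (Phi : 'M[R[i]]_(k, L)).

Lemma compressD A B : compress Phi (A + B) = compress Phi A + compress Phi B.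
Proof. by rewrite /compress mulmxDr mulmxDl. Qed.

Lemma compressZ a A : compress Phi (a *: A) = a *: compress Phi A.
Proof. by rewrite /compress -scalemxAr -scalemxAl. Qed.

Lemma compress0 : compress Phi 0 = 0.
Proof. by rewrite /compress mulmx0 mul0mx. Qed.

Lemma compress_sum n (c : 'I_n -> R[i]) (v : 'I_n -> 'M[R[i]]_L) :
  compress Phi (\sum_i c i *: v i) = \sum_i c i *: compress Phi (v i).
Proof.
rewrite (big_morph _ compressD compress0).
by apply: eq_bigr => i _; rewrite compressZ.
Qed.

(** By linearity of [compress Phi], once a preimage in [S] is chosen for each generator. *)
Lemma compress_real_span (S : set 'M[R[i]]_L) :
  real_span (compress Phi @` S) = compress Phi @` real_span S.
Proof.
apply/seteqP; split=> [B [n [c [v [Sv ->]]]]|B [A [n [c [v [Sv ->]]]] <-]].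
  have /boolp.choice [w wP] : forall i, exists A, S A /\ compress Phi A = v i.
    by move=> i; have [A SA <-] := Sv i; exists A.
  exists (\sum_i (c i)%:C%C *: w i).
    by exists n, c, w; split=> // i; case: (wP i).
  by rewrite compress_sum; apply: eq_bigr => i _; case: (wP i) => _ ->.
exists n, c, (fun i => compress Phi (v i)); split; last exact: compress_sum.
by move=> i; exists (v i).
Qed.

(** Surjectivity is automatic, the codomain being the image of the span. *)
Lemma covariance_samplerE (S : set 'M[R[i]]_L) :
  covariance_sampler S Phi <-> set_inj (real_span S) (compress Phi).
Proof.
rewrite /covariance_sampler compress_real_span; split=> [[]//|injPhi].
by split=> // A SA; exists A.
Qed.

End Compression.

Lemma compress_row_selectionE (R : realType) L (K : {set 'I_L})
    (A : 'M[R[i]]_L) i j :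
  compress (row_selection R K) A i j = A (enum_val i) (enum_val j).
Proof.
rewrite /compress /row_selection; set E := rowsub _ _.
(* The entries of [E] are 0 or 1, so conjugation fixes them. *)
have -> : (E ^t*)%sesqui = E^T by apply/matrixP => m n; rewrite !mxE rmorph_nat.
rewrite mul_rowsub_mx mul1mx trmx_mxsub trmx1.
by rewrite mulmx_colsub mulmx1 !mxE.
Qed.

Lemma cdist_modz L (L_gt0 : (0 < L)%N) (m n : 'I_L) :
  (((n : nat)%:Z - (m : nat)%:Z) %% L%:Z)%Z = (cdist L_gt0 m n : nat)%:Z.
Proof.
have := ltn_ord m; rewrite /= -modz_nat => mL.
(* Adding [L] avoids a negative difference and matches the form [n + (L - m)] used by [cdist]. *)
rewrite -(modzDr ((n : nat)%:Z - (m : nat)%:Z) L%:Z).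
by congr (_ %% _)%Z; lia.
Qed.

(** Remainders mod [L] always lie in [[0, L)], so only the covering of all residues is at stake. *)
Lemma modular_difference_setP L (L_gt0 : (0 < L)%N) (K : {set 'I_L}) :
  modular_difference_set L [set (k : nat)%:Z | k in [set` K]] =
    [set d : int | 0 <= d < L%:Z] <->
  forall d : 'I_L, exists m n, [/\ m \in K, n \in K & cdist L_gt0 m n = d].
Proof.
split=> [KE d|KP].
  have : [set d : int | 0 <= d < L%:Z] (d : nat)%:Z.
    by rewrite /= ltz_nat ltn_ord.
  rewrite -KE => -[_ [_ [_ [[m mK <-] [n nK <-]]]]].
  by rewrite (cdist_modz L_gt0) => -[dE]; exists m, n; split=> //; apply: val_inj.
apply/seteqP; split=> d /=.
  move=> [d_ge0 [_ [_ [[m _ <-] [n _ <-]]]]] ->.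
  by rewrite (cdist_modz L_gt0) ltz_nat ltn_ord.
case: d => // d /andP[_ dL]; split=> //.
have [m [n [mK nK mnE]]] := KP (Ordinal (dL : (d < L)%N)).
exists (m : nat)%:Z, (n : nat)%:Z; split; [by exists m|by exists n|].
by rewrite (cdist_modz L_gt0) mnE.
Qed.

(** The sum over both orders of the indices makes this real matrix symmetric, hence Hermitian;
    entries equal 2 where [d] is its own negative mod [L]. *)
Definition circulant_indicator (R : realType) L (L_gt0 : (0 < L)%N) (d : 'I_L) :
    'M[R[i]]_L :=
  \matrix_(m, n) ((cdist L_gt0 m n == d)%:R + (cdist L_gt0 n m == d)%:R).

Lemma circulant_indicator_span (R : realType) L (L_gt0 : (0 < L)%N) (d : 'I_L) :
  real_span (hermitian_circulant_basis R L) (circulant_indicator R L_gt0 d).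
Proof.
rewrite hermitian_circulant_basis_span //; split.
  apply/hermitianP => m n.
  by rewrite !mxE rmorphD /= !rmorph_nat addrC.
apply/(circulantP L_gt0) => m n; rewrite !mxE cdist0.
congr (_ + (_ == _)%:R); apply: ord_inj.
(* Both sides are the negative of [cdist m n] mod [L]. *)
by rewrite cdist_sym [RHS]cdist_sym cdist0.
Qed.

(** The entry at [(0, d)] is 1 or 2, nonzero in characteristic 0. *)
Lemma circulant_indicator_neq0 (R : realType) L (L_gt0 : (0 < L)%N) (d : 'I_L) :
  circulant_indicator R L_gt0 d <> 0.
Proof.
move=> /matrixP /(_ (Ordinal L_gt0) d); rewrite !mxE cdist0 eqxx -natrD.
by move/eqP; rewrite pnatr_eq0.
Qed.

Theorem theorem6 (R : realType) (L : nat) (L_gt0 : (0 < L)%N) (K : {set 'I_L}) :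
  set_covariance_sampler (hermitian_circulant_basis R L) K <->
  modular_difference_set L [set (k : nat)%:Z | k in [set` K]] =
    [set d : int | 0 <= d < L%:Z].
Proof.
apply: (iff_trans (covariance_samplerE _ _)).
apply: (iff_trans _ (iff_sym (modular_difference_setP L_gt0 K))).
split=> [injK d|KP A B].
  apply: boolp.contrapT => nd.
  apply: (@circulant_indicator_neq0 R L L_gt0 d).
  apply: injK; rewrite ?inE; [exact: circulant_indicator_span|exact: real_span0|].
  rewrite compress0; apply/matrixP => i j.
  rewrite compress_row_selectionE !mxE.
  have no_d m n : m \in K -> n \in K -> (cdist L_gt0 m n == d) = false.
    by move=> mK nK; apply/eqP => mnd; apply: nd; exists m, n.
  by rewrite !no_d ?enum_valP // addr0.
rewrite !inE hermitian_circulant_basis_span // => -[_ /(circulantP L_gt0) cA].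
move=> [_ /(circulantP L_gt0) cB] AB; apply/matrixP => m n; rewrite cA cB.
(* Move to a position in [K] with the same residue, where the entry is visible in the
   compression. *)
have [m' [n' [m'K n'K <-]]] := KP (cdist L_gt0 m n).
rewrite -cA -cB -(enum_rankK_in m'K m'K) -(enum_rankK_in n'K n'K).
by rewrite -!compress_row_selectionE AB.
Qed.
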